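(* Let $\lambda$ be an admissible probability measure on $\mathcal X$, let $\mathcal A_1,\dots,\mathcal A_r$ be bounded Borel subsets of $\mathbb R^k$ with $\mathrm{vol}_{\mathbb R^k}(\partial\mathcal A_i)=0$ for all $i$, and let $N\in\mathbb Z_{\ge0}^r$. Then $$\lim_{L\to\infty}\lambda\big(\{x\in\mathcal X:\#\{j:L^{-n/k}\xi_j(x,L)\in\mathcal A_i\}=N_i\ \forall i\}\big)=\mu\big(\{\Gamma g\in\mathcal X:\#(\widehat{\mathbb Z}^ng\cap\mathcal C(\mathcal A_i,\mathcal W))=N_i\ \forall i\}\big).$$
   Context: Fix integers $k\ge1$, $m\ge0$ and set $n=k+m+1$. Let $G=\mathrm{SL}(n,\mathbb R)$, $\Gamma=\mathrm{SL}(n,\mathbb Z)$, $\mathcal X=\Gamma\backslash G$, and let $\mu$ be the unique right-$G$-invariant Borel probability measure on $\mathcal X$. Vectors in $\mathbb R^n$ are row vectors $y=(y',y'',y_n)\in\mathbb R^k\times\mathbb R^m\times\mathbb R$; $G$ acts from the right. $\widehat{\mathbb Z}^n$ is the set of primitive integer vectors. For $s\in\mathbb R^k$ let $U(s)=\begin{pmatrix}1_k&0&0\\0&1_m&0\\-s&0&1\end{pmatrix}$ (middle block absent if $m=0$), so $yU(s)=(y'-y_ns,y'',y_n)$, and $h_s(x)=xU(s)$. Let $\Phi(t)=\mathrm{diag}(e^{(m+1)t}1_k,e^{-kt}1_m,e^{-kt})$, $\varphi_t(x)=x\Phi(t)$, and $\varphi_tE=\{\varphi_t(x):x\in E\}$.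 A Borel probability measure $\lambda$ on $\mathcal X$ is admissible if $\lim_{t\to\infty}\lambda(\varphi_tE)=\mu(E)$ for every Borel $E\subset\mathcal X$ with $\mu(\partial E)=0$. Fix a norm $|\cdot|$ on $\mathbb R^k$. Let $\mathcal W\subset\mathbb R^m\times\mathbb R_{>0}$ be a bounded Borel set with non-empty interior and boundary of Lebesgue measure zero; $\mathcal C(\mathcal A,\widetilde{\mathcal W})=\{y:y'\in y_n\mathcal A,(y'',y_n)\in\widetilde{\mathcal W}\}$. Hitting times: for $x=\Gamma g$, $L>0$, $\xi_1(x,L),\xi_2(x,L),\dots$ lists with multiplicity the multiset $\{v'/v_n:v\in\widehat{\mathbb Z}^ng,(v'',v_n)\in L^{-1}\mathcal W\}$ ordered by nondecreasing $|\cdot|$; so $\#\{j:\xi_j(x,L)\in\mathcal A\}=\#(\widehat{\mathbb Z}^ng\cap\mathcal C(\mathcal A,L^{-1}\mathcal W))$. (These are the times the orbit $h_s(x)$ meets the section $\Gamma\backslash\Gamma H\{R(w):w\in L^{-1}\mathcal W\}$, with multiplicity.) *)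

(* Defs.v *)
From HB Require Import structures.
From mathcomp Require Import all_boot all_order all_algebra.
From mathcomp Require Import all_classical all_reals all_analysis.
Set Implicit Arguments. Unset Strict Implicit. Unset Printing Implicit Defensive.
Import Order.TTheory GRing.Theory Num.Theory.
Local Open Scope classical_set_scope.
Local Open Scope ring_scope.

(* Dimensions: n = k + m + 1, written (k + m).+1.
   Coordinates of y : 'rV_n : indices 0..k-1 form y', k..k+m-1 form y'',
   index k+m (= ord_max) is y_n. *)

Section Defs.
Variable R : realType.

Definition mxdist (p q : nat) (A B : 'M[R]_(p, q)) (e : R) : Prop :=
  forall i j, `|A i j - B i j| < e.

Definition SL (n : nat) := {A : 'M[R]_n.+1 | \det A == 1}.

HB.instance Definition _ n := Choice.on (SL n).

Lemma det1_SL n : \det (1%:M : 'M[R]_n.+1) == 1.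
Proof. by rewrite det1. Qed.

HB.instance Definition _ n := isPointed.Build (SL n) (exist _ 1%:M (det1_SL n)).

Definition Gamma (n : nat) : set 'M[R]_n.+1 :=
  [set M | exists Z : 'M[int]_n.+1, M = map_mx intr Z /\ \det Z = 1].

(* left-Gamma-invariant subsets of G: these are the subsets of X = Gamma\G *)
Definition Gamma_inv n (E : set (SL n)) : Prop :=
  forall (gam : 'M[R]_n.+1) (x y : SL n), @Gamma n gam ->
    val y = gam *m val x -> (E x <-> E y).

Definition SL_open n (U : set (SL n)) : Prop :=
  forall x, U x -> exists2 e : R, 0 < e &
    forall y : SL n, mxdist (val x) (val y) e -> U y.

Definition SL_borel n : set (set (SL n)) := <<s [set U | SL_open U] >>.

Definition SL_boundary n (E : set (SL n)) : set (SL n) :=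
  [set x | forall e : R, 0 < e ->
     (exists y, E y /\ mxdist (val x) (val y) e) /\
     (exists y, ~ E y /\ mxdist (val x) (val y) e)].

(* Borel sets of X = Gamma\G, pulled back to G *)
Definition X_sets n : set (set (SL n)) :=
  [set E | SL_borel E /\ Gamma_inv E].

(* the measurable space X = Gamma\G (points: representatives g in G) *)
Local Notation X n := (g_sigma_algebraType (@X_sets n)).

Definition rtrans n (E : set (X n)) (h : 'M[R]_n.+1) : set (X n) :=
  [set x | exists2 y, E y & val x = val y *m h].

Definition Phi (k m : nat) (t : R) : 'M[R]_((k + m).+1) :=
  diag_mx (\row_(i < (k + m).+1)
     (if (i < k)%N then expR (m.+1%:R * t) else expR (- (k%:R * t)))).

Definition phiset k m (t : R) (E : set (X (k + m))) : set (X (k + m)) :=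
  rtrans E (@Phi k m t).

Definition right_G_invariant n (mu : set (X n) -> \bar R) : Prop :=
  forall (E : set (X n)), measurable E -> forall h : SL n,
    mu (rtrans E (val h)) = mu E.

Definition admissible k m (mu lam : set (X (k + m)) -> \bar R) : Prop :=
  forall E : set (X (k + m)), measurable E -> mu (SL_boundary E) = 0%E ->
    lam (@phiset k m t E) @[t --> +oo] --> mu E.

Definition rv_bounded p (A : set 'rV[R]_p) : Prop :=
  exists M : R, forall y, A y -> forall i, `|y 0 i| <= M.

Definition rv_open p (U : set 'rV[R]_p) : Prop :=
  forall x, U x -> exists2 e : R, 0 < e &
    forall y, mxdist x y e -> U y.

Definition rv_borel p : set (set 'rV[R]_p) := <<s [set U | rv_open U] >>.

Definition rv_boundary p (A : set 'rV[R]_p) : set 'rV[R]_p :=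
  [set x | forall e : R, 0 < e ->
     (exists y, A y /\ mxdist x y e) /\ (exists y, ~ A y /\ mxdist x y e)].

Definition rv_nonempty_interior p (A : set 'rV[R]_p) : Prop :=
  exists x, exists2 e : R, 0 < e & forall y, mxdist x y e -> A y.

Definition box p (a b : 'rV[R]_p) : set 'rV[R]_p :=
  [set y | forall i, a 0 i <= y 0 i <= b 0 i].
Definition box_vol p (a b : 'rV[R]_p) : R :=
  \prod_(i < p) Num.max (b 0 i - a 0 i) 0.

Definition leb_null p (S : set 'rV[R]_p) : Prop :=
  forall eps : R, 0 < eps -> exists a b : nat -> 'rV[R]_p,
    S `<=` \bigcup_j box (a j) (b j) /\
    forall N, \sum_(j < N) box_vol (a j) (b j) <= eps.

Definition primitive p (a : 'rV[int]_p) : Prop :=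
  forall d : int, (forall i, (d %| a ord0 i)%Z) -> `|d| = 1.

Definition yp k m (y : 'rV[R]_((k + m).+1)) : 'rV[R]_k :=
  \row_(i < k) y 0 (inord i).
(* (y'', y_n) as a vector of R^(m+1) *)
Definition ypp k m (y : 'rV[R]_((k + m).+1)) : 'rV[R]_m.+1 :=
  \row_(i < m.+1) y 0 (inord (k + i)).
Definition ylast k m (y : 'rV[R]_((k + m).+1)) : R := y 0 ord_max.

Definition cone k m (A : set 'rV[R]_k) (W : set 'rV[R]_m.+1)
  (y : 'rV[R]_((k + m).+1)) : Prop :=
  (exists2 a, A a & yp y = ylast y *: a) /\ W (ypp y).

(* primitive integer vectors a with a g in the cone: indexes
   Zhat^n g ∩ C(A,W) bijectively (g is invertible) *)
Definition cone_points k m (A : set 'rV[R]_k) (W : set 'rV[R]_m.+1)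
  (x : X (k + m)) : set 'rV[int]_((k + m).+1) :=
  [set a | primitive a /\ cone A W (map_mx intr a *m val x)].

(* hitting-time count  #{ j : L^(-n/k) xi_j(x,L) \in A }:
   the multiset {v'/v_n : v in Zhat^n g, (v'',v_n) in L^-1 W} counted with
   multiplicity, indexed by primitive a with v = a g *)
Definition hit_points k m (W : set 'rV[R]_m.+1) (L : R) (A : set 'rV[R]_k)
  (x : X (k + m)) : set 'rV[int]_((k + m).+1) :=
  [set a | primitive a /\
     let v := map_mx intr a *m val x in
     [set L^-1 *: w | w in W] (ypp v) /\
     A (L `^ (- ((k + m).+1%:R / k%:R)) *: ((ylast v)^-1 *: yp v))].

End Defs.

(* the measurable space X = Gamma\G over R, n = dim - 1 *)
Notation Xsp R n := (g_sigma_algebraType (@X_sets R n)).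

(* Main.v *)
Require Import Defs.
From HB Require Import structures.
From mathcomp Require Import all_boot all_order all_algebra.
From mathcomp Require Import all_classical all_reals all_analysis.
From mathcomp Require Import measurable_realfun zify ring lra.
Import Order.TTheory GRing.Theory Num.Theory.
Import numFieldNormedType.Exports.
Local Open Scope classical_set_scope.
Local Open Scope ring_scope.
Local Open Scope card_scope.

(** With [L = e^(kt)], the hitting-time count of [x] at level [L] is the cone count
    of [x Phi(-t)], so the hitting event is [phi_t E] for a fixed [E] and
    admissibility gives the limit as soon as [mu (boundary E) = 0]. Cone counts are
    locally constant at every lattice with no primitive vector on the boundary of a
    cone, so it suffices that almost no lattice has a primitive vector in a
    given Lebesgue-null set. This follows from invariance alone, without
    Siegel's formula: a small box [Q] has about [1 / vol Q] disjoint images under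
    shears, all inside a fixed ball; a lattice with at most [r] primitive points in
    that ball meets at most [r] of these images, and every image is met with
    the same probability, which is therefore [O(r vol Q)]. Covering the null set
    by boxes and letting [r] grow concludes. *)

(** * Measurability and Gamma-invariance *)

(** Matrix entries are not Gamma-invariant, so measurability is proved on [G] with all its Borel
    sets; a set passes to [Xsp] once its invariance is known as well. *)
Notation Gsp R n := (g_sigma_algebraType [set U | @SL_open R n U]).

Definition prim_points {R : realType} {n : nat} (P : set 'rV[R]_n.+1)
    (x : SL R n) : set 'rV[int]_n.+1 :=
  [set a | primitive a /\ P (map_mx intr a *m val x)].

Lemma mxdist_mulmx {R : realType} {p q s : nat} (C : 'M[R]_(p, q)) (e : R) :
  0 < e -> exists2 d : R, 0 < d &
    forall A B : 'M[R]_(q, s), mxdist A B d -> mxdist (C *m A) (C *m B) e.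
Proof.
(* [S] dominates every absolute row sum of [C]; adding 1 keeps the divisor positive when [C = 0]. *)
move=> e0; pose S := \sum_i \sum_j `|C i j|.
have S0 : 0 <= S by apply: sumr_ge0 => i _; apply: sumr_ge0.
have S1 : 0 < 1 + S by rewrite ltr_wpDr.
exists (e / (1 + S)); first by rewrite divr_gt0.
move=> A B AB i j; rewrite !mxE -sumrB.
apply: (le_lt_trans (ler_norm_sum _ _ _)).
apply: (@le_lt_trans _ _ (\sum_k `|C i k| * (e / (1 + S)))).
  apply: ler_sum => k _; rewrite -mulrBr normrM ler_wpM2l//.
  exact/ltW/AB.
rewrite -mulr_suml mulrA ltr_pdivrMr// mulrC ltr_pM2l//.
apply: (@le_lt_trans _ _ S); last by rewrite ltrDr.
rewrite /S (bigD1 i)//= lerDl; apply: sumr_ge0 => l _; exact: sumr_ge0.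
Qed.

Lemma mxdist_mulmxr {R : realType} {p q s : nat} (C : 'M[R]_(q, s)) (e : R) :
  0 < e -> exists2 d : R, 0 < d &
    forall A B : 'M[R]_(p, q), mxdist A B d -> mxdist (A *m C) (B *m C) e.
Proof.
move=> /(@mxdist_mulmx _ _ _ p C^T)[d d0 H]; exists d => // A B AB i j.
have : mxdist A^T B^T d by move=> k l; rewrite !mxE.
by move=> /H/(_ j i); rewrite -!trmx_mul !mxE.
Qed.

Lemma measurable_entry {R : realType} {n : nat} (i j : 'I_n.+1) :
  measurable_fun [set: Gsp R n] (fun x => val x i j).
Proof.
apply: (measurability _ (RGenOInfty.measurableE R)) => //.
move=> _ [_ [a ->] <-]; rewrite setTI; apply: sub_sigma_algebra => x /=.
rewrite in_itv/= andbT => ax; exists (val x i j - a); first by rewrite subr_gt0.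
move=> y /(_ i j) xy /=; rewrite in_itv/= andbT.
by move: xy; rewrite ltr_distlC; lra.
Qed.

Lemma measurable_act {R : realType} {n : nat} (a : 'rV[R]_n.+1) (j : 'I_n.+1) :
  measurable_fun [set: Gsp R n] (fun x => (a *m val x) 0 j).
Proof.
have -> : (fun x : Gsp R n => (a *m val x) 0 j) =
    (fun x => \sum_i a 0 i * val x i j) by apply/funext => x; rewrite mxE.
apply: measurable_sum => i; apply: measurable_funM => //.
exact: measurable_entry.
Qed.

(** An open set is a countable union of boxes with rational corners, and the preimage of a box is a
    finite intersection of preimages of intervals. *)
Lemma rv_borel_preimage {R : realType} d (T : measurableType d) p
    (f : 'I_p -> T -> R) (A : set 'rV[R]_p) :
  (forall i, measurable_fun [set: T] (f i)) -> rv_borel A ->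
  measurable [set x | A (\row_i f i x)].
Proof.
move=> mf; pose F x := \row_i f i x.
suff : (@rv_borel R p) `<=` [set A | measurable (F @^-1` A)] by exact.
apply: smallest_sub.
  split => /=.
  - by rewrite preimage_set0.
  - by move=> B mB; rewrite setTD preimage_setC; exact: measurableC.
  - by move=> B mB; rewrite preimage_bigcup; exact: bigcup_measurable.
move=> U oU /=.
pose inbox (q : 'rV[rat]_p * 'rV[rat]_p) : set 'rV[R]_p :=
  [set y | forall i, ratr (q.1 0 i) < y 0 i < ratr (q.2 0 i)].
pose Z (q : 'rV[rat]_p * 'rV[rat]_p) : set T :=
  if `[< inbox q `<=` U >] then 
    \bigcap_i (f i @^-1` `]ratr (q.1 0 i), ratr (q.2 0 i)[) else set0.
have -> : F @^-1` U = \bigcup_q Z q.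
  rewrite eqEsubset; split => [x /= Ux|x [q _]]; last first.
    rewrite /Z; case: asboolP => // qU H.
    apply: qU => i /=; have := H i I; rewrite /= in_itv/= /F mxE.
    by apply.
  have [e e0 He] := oU _ Ux.
  have H1 i : exists q : rat, ratr q \in `](F x 0 i - e), (F x 0 i)[.
    by apply: rat_in_itvoo; rewrite ltrBlDr ltrDl.
  have H2 i : exists q : rat, ratr q \in `](F x 0 i), (F x 0 i + e)[.
    by apply: rat_in_itvoo; rewrite ltrDl.
  have [q1 Hq1] := choice H1; have [q2 Hq2] := choice H2.
  exists (\row_i q1 i, \row_i q2 i) => //; rewrite /Z; case: asboolP => [_|[]].
    move=> i _ /=; rewrite in_itv/= !mxE.
    move: (Hq1 i) (Hq2 i); rewrite !in_itv/= /F mxE.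
    by move=> /andP[_ ->] /andP[-> _].
  move=> y /= Hy; apply: He => i j; rewrite (ord1 i).
  have := Hy j; move: (Hq1 j) (Hq2 j); rewrite !in_itv/= !mxE => H3 H4 H5.
  by rewrite ltr_distlC; lra.
apply: countable_bigcupT_measurable; first exact: countableP.
move=> q; rewrite /Z; case: asboolP => // _.
apply: fin_bigcap_measurable => // i _.
by rewrite -[X in measurable X]setTI; exact: mf.
Qed.

Lemma countable_bigcapT_measurable d (T : measurableType d) (U : countType)
    (F : U -> set T) :
  (forall i, measurable (F i)) -> measurable (\bigcap_i F i).
Proof.
move=> mF; rewrite -[X in measurable X]setCK setC_bigcap; apply: measurableC.
by apply: countable_bigcupT_measurable => // i; exact: measurableC.
Qed.

(** A countable type has only countably many finite subsets: the event is the union, over the lists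
    [s] with [N] distinct members, of the events that [S x] is the set of members of [s], each a
    countable intersection of membership conditions. *)
Lemma measurable_card_eq {d} {T : measurableType d} {U : countType}
    (S : T -> set U) (N : nat) :
  (forall a, measurable [set x | S x a]) -> measurable [set x | S x #= `I_N].
Proof.
move=> mS.
have -> : [set x | S x #= `I_N] =
    \bigcup_(s : seq U) (if `[< [set` s] #= `I_N >] then
      \bigcap_a (if a \in s then [set x | S x a] else ~` [set x | S x a])
      else set0).
  rewrite eqEsubset; split => [x /= SN|x [s _]]; last first.
    case: asboolP => // sN H /=; suff -> : S x = [set` s] by [].
    rewrite eqEsubset; split => [a Sa|a /= sa]; move: (H a I) => /=.
      by case: ifP.
    by rewrite sa.
  have /finite_seqP[s sE] : finite_set (S x) by apply/finite_setP; exists N.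
  exists s => //; case: asboolP => [_|]; last by rewrite -sE.
  move=> a _; have -> : (a \in s) = `[< S x a >].
    by rewrite sE; apply/idP/asboolP.
  by case: asboolP.
apply: countable_bigcupT_measurable => // s; case: asboolP => // _.
apply: countable_bigcapT_measurable => a; case: ifP => _; first exact: mS.
exact/measurableC/mS.
Qed.

Lemma primitive_mul {n : nat} (Z : 'M[int]_n.+1) (a : 'rV[int]_n.+1) :
  \det Z = 1 -> primitive a -> primitive (a *m Z).
Proof.
move=> Z1 pa d H; apply: pa => i.
(* [\adj Z] inverts [Z] over the integers, so a common divisor of the entries of [a Z] divides those
   of [a]. *)
have -> : a = a *m Z *m \adj Z by rewrite -mulmxA mul_mx_adj Z1 mulmx1.
by rewrite mxE; apply: rpred_sum => j _; exact: dvdz_mulr.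
Qed.

(** If [y = Z x] then [a y = (a Z) x], and [a -> a Z] permutes the primitive vectors. *)
Lemma card_prim_points_Gamma {R : realType} {n : nat} (P : set 'rV[R]_n.+1)
    (gam : 'M[R]_n.+1) (x y : SL R n) : Gamma gam ->
  val y = gam *m val x -> prim_points P y #= prim_points P x.
Proof.
move=> [Z [-> Z1]] yE.
have ZZ : Z *m \adj Z = 1%:M by rewrite mul_mx_adj Z1.
have ZZ' : \adj Z *m Z = 1%:M by rewrite mul_adj_mx Z1.
have adj1 : \det (\adj Z) = 1.
  by have := congr1 determinant ZZ; rewrite det_mulmx Z1 mul1r det1.
have actE (a : 'rV[int]_n.+1) :
    map_mx intr a *m val y = map_mx intr (a *m Z) *m val x.
  by rewrite yE mulmxA map_mxM.
have -> : prim_points P x = (mulmxr Z) @` prim_points P y.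
  rewrite eqEsubset; split => [a [pa Pa]|_ [a [pa Pa] <-]].
    exists (a *m \adj Z); last by rewrite /= -mulmxA ZZ' mulmx1.
    split; first exact: primitive_mul.
    by rewrite actE -mulmxA ZZ' mulmx1.
  by split; [exact: primitive_mul|rewrite -actE].
rewrite card_eq_sym; apply/inj_card_eq => a b _ _ /= /(congr1 (mulmxr (\adj Z))).
by rewrite /= -!mulmxA ZZ !mulmx1.
Qed.

Lemma X_sets_measurable {R : realType} {n : nat} (E : set (Xsp R n)) :
  X_sets E -> measurable E.
Proof. by move=> XE; exact: sub_sigma_algebra. Qed.

Lemma X_sets_card {R : realType} {n : nat} (P : set 'rV[R]_n.+1) (N : nat) :
  (forall a : 'rV[R]_n.+1, SL_borel [set x : SL R n | P (a *m val x)]) ->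
  X_sets [set x : SL R n | prim_points P x #= `I_N].
Proof.
move=> mP; split.
  apply: (@measurable_card_eq _ (Gsp R n)) => a.
  have [pa|npa] := pselect (primitive a).
    have -> : [set x : Gsp R n | prim_points P x a] =
        [set x | P (map_mx intr a *m val x)].
      by apply/seteqP; split => x /=; [case|split].
    exact: mP.
  suff -> : [set x : Gsp R n | prim_points P x a] = set0 by [].
  by apply/seteqP; split => x //= [].
move=> gam x y Gg /(card_prim_points_Gamma P _ _ _ Gg) xy /=.
split => xN; first by apply: (card_eq_trans xy).
by apply: card_eq_trans xN; rewrite card_eq_sym.
Qed.

(** * Right translations and shears *)

Lemma det_SLmul {R : realType} {n : nat} (x h : SL R n) :
  \det (val x *m val h) == 1.
Proof. by rewrite det_mulmx (eqP (valP x)) (eqP (valP h)) mulr1. Qed.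

Definition SLmul {R : realType} {n : nat} (x h : SL R n) : SL R n :=
  exist _ (val x *m val h) (det_SLmul x h).

(** The translate is the preimage of [E] under the continuous map [x -> x h'], which commutes with
    the left action of Gamma. *)
Lemma X_sets_rtrans {R : realType} {n : nat} (E : set (SL R n)) (h h' : SL R n) :
  val h *m val h' = 1%:M -> X_sets E -> X_sets (rtrans E (val h)).
Proof.
move=> hh' [bE iE].
have h'h : val h' *m val h = 1%:M by apply: mulmx1C.
have -> : rtrans E (val h) = (fun x => SLmul x h') @^-1` E.
  apply/seteqP; split => [x /= [y Ey xE]|x /= Ex].
    suff -> : SLmul x h' = y by [].
    by apply: val_inj; rewrite /= xE -mulmxA hh' mulmx1.
  by exists (SLmul x h') => //=; rewrite -mulmxA h'h mulmx1.
split; last first.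
  move=> gam x y Gg yE; apply: (iE gam) => //=; by rewrite yE mulmxA.
suff : measurable_fun [set: Gsp R n] (fun x : Gsp R n => SLmul x h' : Gsp R n).
  by move=> /(_ measurableT E bE); rewrite setTI.
apply: (@measurability _ _ (Gsp R n) (Gsp R n) setT _ [set U | @SL_open R n U]) => //.
move=> _ [U oU <-]; rewrite setTI; apply: sub_sigma_algebra => x /= Ux.
have [e e0 He] := oU _ Ux.
have [d d0 Hd] := @mxdist_mulmxr R n.+1 n.+1 n.+1 (val h') _ e0.
by exists d => // y xy; apply: He; exact: Hd.
Qed.

Definition shear_mx {R : realType} {n : nat} (j : 'I_n.+1) (u : 'rV[R]_n.+1) :
  'M[R]_n.+1 := 1%:M + delta_mx j (ord0 : 'I_1) *m u.

Lemma mul_shear_mx {R : realType} {n : nat} (j : 'I_n.+1) (u y : 'rV[R]_n.+1) :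
  y *m shear_mx j u = y + y 0 j *: u.
Proof.
rewrite mulmxDr mulmx1 mulmxA -colE; congr (_ + _).
by apply/rowP => i; rewrite !mxE big_ord1 !mxE.
Qed.

Lemma det_shear_mx {R : realType} {n : nat} (j : 'I_n.+1) (u : 'rV[R]_n.+1) :
  u 0 j = 0 -> \det (shear_mx j u) == 1.
Proof.
move=> uj.
(* By linearity in row [j], the determinant is that of the identity plus that of [C], whose column
   [j] vanishes because [u 0 j = 0]. *)
pose C : 'M[R]_n.+1 := \matrix_(i, l) if i == j then u 0 l else (i == l)%:R.
rewrite (@determinant_multilinear _ _ _ 1%:M C j 1 1); last 3 first.
- by apply/rowP => l; rewrite !mxE !eqxx big_ord1 !mxE !eqxx !mul1r.
- apply/matrixP => i l; rewrite !mxE big_ord1 !mxE [lift j i == j]eq_sym (negPf (neq_lift _ _)).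
  by rewrite /= mul0r addr0.
- apply/matrixP => i l; rewrite !mxE big_ord1 !mxE [lift j i == j]eq_sym (negPf (neq_lift _ _)).
  by rewrite /= mul0r addr0.
rewrite det1 mul1r (_ : \det C = 0) ?mulr0 ?addr0//.
rewrite (expand_det_col _ j) big1// => i _; rewrite mxE.
by case: eqP => [->|_]; rewrite ?uj mul0r.
Qed.

Definition shear {R : realType} {n : nat} (j : 'I_n.+1) (u : 'rV[R]_n.+1)
  (uj : u 0 j = 0) : SL R n := exist _ (shear_mx j u) (det_shear_mx j u uj).

Lemma shear_mxN {R : realType} {n : nat} (j : 'I_n.+1) (u : 'rV[R]_n.+1) :
  u 0 j = 0 -> shear_mx j u *m shear_mx j (- u) = 1%:M.
Proof.
move=> uj; apply/row_matrixP => i; rewrite row_mul row1.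
rewrite mul_shear_mx /shear_mx.
have -> : row i (1%:M + delta_mx j (ord0 : 'I_1) *m u) =
    delta_mx 0 i *m shear_mx j u by rewrite -rowE.
by rewrite mul_shear_mx !mxE uj mulr0 addr0 scalerN addrK.
Qed.

(** The sum of the indicators of the [D t] counts the sets containing a point; integrate the bound
    [r] on this count. *)
Lemma sum_measure_multiplicity {R : realType} {d} {T : measurableType d}
    (mu : probability T R) (J : finType) (D : J -> set T) (r : nat) :
  (forall t, measurable (D t)) ->
  (forall z, (#|[pred t | `[< D t z >]]| <= r)%N) ->
  (\sum_(t : J) mu (D t) <= r%:R%:E)%E.
Proof.
move=> mD Dr.
have -> : (\sum_(t : J) mu (D t) =
    \int[mu]_(x in setT) \sum_(t : J) (\1_(D t) x)%:E)%E.
  rewrite ge0_integral_sum//; last first.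
    by move=> t; apply/measurable_EFinP; exact: measurable_indic.
  by apply: eq_bigr => t _; rewrite integral_indic// setIT.
have <- : (\int[mu]_(x in setT) (cst r%:R%:E) x = r%:R%:E)%E.
  by rewrite integral_cst// [X in (_ * X)%E](@probability_setT _ _ _ mu) mule1.
apply: ge0_le_integral => //.
- by move=> x _; apply: sume_ge0.
- apply: emeasurable_sum => t; apply/measurable_EFinP; exact: measurable_indic.
- move=> x _; rewrite sumEFin lee_fin/=.
  rewrite (le_trans _ (_ : (#|[pred t | `[< D t x >]]|)%:R <= _))//; last first.
    by rewrite ler_nat.
  rewrite -sum1_card natr_sum [leRHS]big_mkcond/=; apply: ler_sum => t _.
  by rewrite indicE inE; case: asboolP => Dt; [rewrite mem_set|rewrite memNset].
Qed.

(** * Null sets of lattices *)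

Definition sup_ball {R : realType} {n : nat} (M : R) : set 'rV[R]_n :=
  [set y : 'rV[R]_n | forall i, `|y 0 i| <= M].

Definition few_points {R : realType} {n : nat} (r : nat) (M : R)
    (x : SL R n) : Prop :=
  exists2 N, (N <= r)%N & prim_points (sup_ball M) x #= `I_N.

Lemma few_points_seq {R : realType} {n : nat} (r : nat) (M : R) (x : SL R n) :
  few_points r M x ->
  exists2 s, (size s <= r)%N & prim_points (sup_ball M) x `<=` [set` s].
Proof.
move=> [N Nr xN].
have /finite_fsetP[s sE] : finite_set (prim_points (sup_ball M) x).
  by apply/finite_setP; exists N.
exists (finmap.enum_fset s); last by rewrite sE => a.
by move: xN; rewrite sE => /card_eq_fsetP ->.
Qed.

Lemma box_vol_ge0 {R : realType} {p : nat} (a b : 'rV[R]_p) : 0 <= box_vol a b.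
Proof. by apply: prodr_ge0 => i _; rewrite le_max lexx orbT. Qed.

Section null_sets.
Context {R : realType} {n p : nat} (mu : probability (Xsp R n) R).
Hypothesis mu_inv : right_G_invariant mu.
Variables (sigma : 'I_p -> 'I_n.+1) (j : 'I_n.+1) (g : R -> R).
Hypothesis sigma_inj : injective sigma.
Hypothesis sigmaNj : forall i, sigma i != j.
Hypothesis mg : measurable_fun [set: R] g.

(* A shear [y + y_j u] leaves [y_j] fixed and translates [chart y] by
   [y_j g(y_j)] times the [sigma]-coordinates of [u]. With [g] the inverse the
   translation is exact; with [g = 1] its size is controlled on
   [chart_region]. *)
Definition chart (y : 'rV[R]_n.+1) : 'rV[R]_p :=
  \row_i (y 0 (sigma i) * g (y 0 j)).

Lemma chartE (y : 'rV[R]_n.+1) (i : 'I_p) :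
  chart y 0 i = y 0 (sigma i) * g (y 0 j).
Proof. by rewrite mxE. Qed.

Definition chart_region (d M : R) (B : set 'rV[R]_p) : set 'rV[R]_n.+1 :=
  [set y : 'rV[R]_n.+1 | [/\ d <= `|y 0 j * g (y 0 j)|, sup_ball M y & B (chart y)]].

(* The radius [M + M] accounts for two shears with parameters in [0, 1]. *)
Definition hits_few (r : nat) (d M : R) (B : set 'rV[R]_p) : set (Xsp R n) :=
  [set x | prim_points (chart_region d M B) x !=set0 /\ few_points r (M + M) x].

(** Only boxes are treated here: a Lebesgue-null [B] need not be Borel, and its event is later shown
    to be negligible by covering. *)
Lemma X_sets_hits_few r d M a b : X_sets (hits_few r d M (box a b)).
Proof.
have measurable_sup_ball K (v : 'rV[R]_n.+1) :
    SL_borel [set x : SL R n | sup_ball K (v *m val x)].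
  have -> : [set x : SL R n | sup_ball K (v *m val x)] =
      \bigcap_i [set x | `|(v *m val x) 0 i| <= K].
    by apply/seteqP; split => x H i; [move=> _|]; exact: H.
  apply: (@fin_bigcap_measurable _ (Gsp R n)) => // i _.
  have := @measurable_fun_le _ (Gsp R n) R setT (fun x => `|(v *m val x) 0 i|)
     (cst K) measurableT.
  rewrite setTI; apply => //.
  by apply: measurableT_comp => //; exact: measurable_act.
have mchart (v : 'rV[R]_n.+1) :
    SL_borel [set x : SL R n | chart_region d M (box a b) (v *m val x)].
  have mgj : measurable_fun [set: Gsp R n] (fun x => g ((v *m val x) 0 j)).
    by apply: measurableT_comp => //; exact: measurable_act.
  have -> : [set x : SL R n | chart_region d M (box a b) (v *m val x)] =
      [set x | d <= `|(v *m val x) 0 j * g ((v *m val x) 0 j)|] `&`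
      ([set x | sup_ball M (v *m val x)] `&`
      \bigcap_i ([set x | a 0 i <= (v *m val x) 0 (sigma i) * g ((v *m val x) 0 j)]
       `&` [set x | (v *m val x) 0 (sigma i) * g ((v *m val x) 0 j) <= b 0 i])).
    apply/seteqP; split => [x /= [? ? H]|x /= [? [? H]]]; split => //.
      by split => // i _; have := H i; rewrite chartE => /andP[? ?]; split.
    by move=> i; have [/= H1 H2] := H i I; rewrite chartE H1 H2.
  have mle (f h : Gsp R n -> R) : measurable_fun setT f -> measurable_fun setT h ->
      measurable [set x | f x <= h x].
    by move=> mf mh; have := measurable_fun_le measurableT mf mh; rewrite setTI.
  apply: (@measurableI _ (Gsp R n)).
    apply: (mle (cst d)) => //; apply: measurableT_comp => //.
    by apply: measurable_funM => //; exact: measurable_act.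
  apply: (@measurableI _ (Gsp R n)); first exact: measurable_sup_ball.
  apply: (@fin_bigcap_measurable _ (Gsp R n)) => // i _.
  apply: (@measurableI _ (Gsp R n)).
    apply: (mle (cst (a 0 i))) => //.
    by apply: measurable_funM => //; exact: measurable_act.
  apply: (mle _ (cst (b 0 i))) => //.
  by apply: measurable_funM => //; exact: measurable_act.
(* Both conditions are rewritten through events with an exact number of points, which are already
   known to be Borel and Gamma-invariant. *)
have hE : hits_few r d M (box a b) =
    ~` [set x | prim_points (chart_region d M (box a b)) x #= `I_0] `&`
    \bigcup_(N < r.+1) [set x | prim_points (sup_ball (M + M)) x #= `I_N].
  rewrite /hits_few; apply/seteqP; split => [x /= [x0 [N Nr xN]]|x /= [x0 [N Nr xN]]].
    split; last by exists N.
    by apply/negP; rewrite II0 card_eq0; exact/set0P.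
  split; last by exists N.
  by apply/set0P; rewrite -(@card_eq0 _ nat) -II0; exact/negP.
have X0 := @X_sets_card R n _ 0 mchart.
have XN N := @X_sets_card R n _ N (measurable_sup_ball (M + M)).
rewrite hE; split.
  apply: (@measurableI _ (Gsp R n)); first by apply: measurableC; case: X0.
  by apply: bigcup_measurable => N _; case: (XN N).
move=> gam x y Gg yE; split => -[x0 [N Nr xN]].
  split; first by move=> /(X0.2 gam x y Gg yE).
  by exists N => //; apply/((XN N).2 gam x y Gg yE).
split; first by move=> /(X0.2 gam x y Gg yE).
by exists N => //; apply/((XN N).2 gam x y Gg yE).
Qed.


(* The shears with parameters on the grid of steps [l i] in the unit cube move
   [chart_region] to pairwise disjoint sets, so a lattice with at most [r] points
   in the large ball meets at most [r] of them; all these events have the same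
   measure. *)
Lemma hits_few_grid (r : nat) (d M : R) (a b : 'rV[R]_p) (l : 'I_p -> R) :
  0 < d -> (forall i, 0 < l i) -> (forall i, `|b 0 i - a 0 i| < d * l i) ->
  (mu (hits_few r d M (box a b)) <= (r%:R * \prod_i l i)%:E)%E.
Proof.
move=> d0 l0 lab; set B := hits_few r d M (box a b).
have XB : X_sets B by exact: X_sets_hits_few.
have mB : measurable B := X_sets_measurable _ XB.
(* The grid parameters [0, l i, ..., (K i - 1) * l i] stay in [[0, 1]], while [K i * l i] exceeds 1;
   the first fact bounds the shears, the second their number. *)
pose K i := (Num.truncn (l i)^-1).+1.
pose J : finType := {dffun forall i : 'I_p, 'I_(K i)}.
have [u [uj us u01]] : exists u : J -> 'rV[R]_n.+1, [/\ forall t, u t 0 j = 0,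
    forall t i, u t 0 (sigma i) = (t i : nat)%:R * l i &
    forall t c, 0 <= u t 0 c <= 1].
  exists (fun t : J => \row_c
    (if [pick i | sigma i == c] is Some i then (t i : nat)%:R * l i else 0)).
  split=> [t|t i|t c]; rewrite mxE.
  - by case: pickP => // i /eqP ij; have := sigmaNj i; rewrite ij eqxx.
  - by case: pickP => [i' /eqP/sigma_inj ->//|/(_ i)]; rewrite eqxx.
  - case: pickP => [i _|_]; last by rewrite lexx ler01.
    rewrite mulr_ge0 ?(ltW (l0 i))//= -ler_pdivlMr// div1r.
    apply: (@le_trans _ _ (Num.truncn (l i)^-1)%:R).
      by rewrite ler_nat -ltnS ltn_ord.
    by rewrite Num.Theory.truncn_le// invr_ge0 ltW.
pose D (t : J) : set (Xsp R n) := rtrans B (shear_mx j (u t)).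
have uNj t : (- u t) 0 j = 0 by rewrite mxE uj oppr0.
have DX t : X_sets (D t).
  apply: (@X_sets_rtrans R n B (shear j (u t) (uj t)) (shear j (- u t) (uNj t))).
    exact: shear_mxN.
  exact: XB.
have muD t : mu (D t) = mu B by exact: (mu_inv _ mB (shear j (u t) (uj t))).
(* Shears fix coordinate [j], so [y] and [y'] agree there. If [t i] and [t' i] differ, the two
   charts are at least [d * l i] apart in coordinate [i], more than the side of the box. *)
have sep y y' t t' : chart_region d M (box a b) y -> chart_region d M (box a b) y' ->
    y *m shear_mx j (u t) = y' *m shear_mx j (u t') -> t = t'.
  move=> [dy _ yB] [_ _ y'B]; rewrite !mul_shear_mx => E.
  have jE : y' 0 j = y 0 j.
    by have /rowP/(_ j) := E; rewrite !mxE !uj !mulr0 !addr0.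
  apply/ffunP => i; apply/eqP/contraT => /eqP tt'.
  have := lab i; rewrite ltNge => /negP[].
  apply: (@le_trans _ _ (`|y 0 j * g (y 0 j)| * (`|(t' i : nat)%:R - (t i : nat)%:R| * l i))).
    rewrite ler_pM ?(ltW d0) ?(ltW (l0 i))//.
    rewrite ler_peMl ?(ltW (l0 i))//.
    rewrite norm_intr_ge1 ?rpredB ?natr_int// subr_eq0 eqr_nat eq_sym.
    by apply/negP => /eqP/ord_inj.
  have Ei : y 0 (sigma i) - y' 0 (sigma i) =
      y 0 j * (((t' i : nat)%:R - (t i : nat)%:R) * l i).
    have /rowP/(_ (sigma i)) := E; rewrite !mxE jE !us => Es; lra.
  have := yB i; have := y'B i; rewrite !chartE jE => /andP[h1 h2] /andP[h3 h4].
  rewrite -[l i]gtr0_norm// -!normrM.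
  rewrite [X in `|X|](_ : _ = y 0 (sigma i) * g (y 0 j) - y' 0 (sigma i) * g (y 0 j)); last first.
    by rewrite -mulrBl Ei; ring.
  rewrite [leRHS]ger0_norm; last by lra.
  by rewrite ler_norml; lra.
(* The two shears together add [y_j (u t - u t0)], whose entries are at most [M] in absolute
   value. *)
have bound y t t0 : sup_ball M y ->
    sup_ball (M + M) (y *m shear_mx j (u t) *m shear_mx j (- u t0)).
  move=> yM i; rewrite !mul_shear_mx !mxE uj mulr0 addr0 -addrA -mulrDr.
  rewrite (le_trans (ler_normD _ _))// lerD// normrM -[leRHS]mulr1 ler_pM//.
  have := u01 t i; have := u01 t0 i => /andP[? ?] /andP[? ?].
  by rewrite ler_norml; lra.
(* Fix one [t0] with [z] in [D t0] and let [x0] be [z] sheared back by it. Every [t] with [z] in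
   [D t] supplies a primitive vector among the at most [r] points of [x0] in the large ball, and by
   [sep] this vector determines [t]. *)
have mult z : (#|[pred t | `[< D t z >]]| <= r)%N.
  case: (pickP [pred t | `[< D t z >]]) => [t0 /asboolP[x0 [_ Bx0] zE0]|no]; last first.
    by rewrite eq_card0.
  have [s sr sP] := few_points_seq _ _ _ Bx0.
  have /choice[A AP] t : exists v : 'rV[int]_n.+1, D t z -> v \in s /\
      exists2 y, chart_region d M (box a b) y &
        map_mx intr v *m val z = y *m shear_mx j (u t).
    have [[x [[v [pv vy]] _] zE]|nD] := pselect (D t z); last by exists 0.
    exists v => _; split; last first.
      by exists (map_mx intr v *m val x) => //; rewrite zE mulmxA.
    apply: sP; split => //.
    have -> : val x0 = val z *m shear_mx j (- u t0).
      by rewrite zE0 -mulmxA shear_mxN// mulmx1.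
    by rewrite zE mulmxA mulmxA; case: vy => _ yM _; exact: bound.
  rewrite cardE -(size_map A) (leq_trans _ sr)//; apply: uniq_leq_size.
    rewrite map_inj_in_uniq ?enum_uniq// => t t'.
    rewrite !mem_enum !inE => Dt Dt' AA.
    have [_ [y yT yE]] := AP _ Dt; have [_ [y' y'T y'E]] := AP _ Dt'.
    by apply: (sep y y') => //; rewrite -yE -y'E AA.
  by move=> v /mapP[t]; rewrite mem_enum inE => Dt ->; have [] := AP _ Dt.
have := sum_measure_multiplicity mu J D r (fun t => X_sets_measurable _ (DX t)) mult.
rewrite (eq_bigr _ (fun t _ => muD t)).
have <- : (fine (mu B))%:E = mu B by apply: fineK; exact: fin_num_measure.
rewrite sumEFin !lee_fin sumr_const => H.
(* The product is [#|J|] times the product of the [l i], which turns [#|J| * mu B <= r] into the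
   claimed bound. *)
have l1 : 1 <= \prod_i ((K i)%:R * l i).
  elim/big_rec: _ => // i x _ x1; rewrite mulr_ege1//.
  by rewrite -ler_pdivrMr// div1r ltW// truncnS_gt.
apply: (@le_trans _ _ (fine (mu B) * \prod_i ((K i)%:R * l i))).
  by rewrite ler_peMr// fine_ge0.
rewrite big_split/= mulrA ler_wpM2r//.
  by apply: prodr_ge0 => i _; exact/ltW.
apply: le_trans H; rewrite -natr_prod mulr_natr.
suff -> : (\prod_i K i)%N = #|J| by [].
rewrite card_dep_ffun foldrE big_map big_enum/=.
by apply: eq_bigr => i _; rewrite card_ord.
Qed.


(** The grid bound needs steps strictly larger than the sides divided by [d], and sides may be zero.
    Steps [(b i - a i) / d + e] are allowed for every [e > 0]; the resulting bound is a polynomial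
    in [e], hence continuous at 0. *)
Lemma hits_few_box (r : nat) (d M : R) (a b : 'rV[R]_p) : 0 < d ->
  (mu (hits_few r d M (box a b)) <= (r%:R * d^-1 ^+ p * box_vol a b)%:E)%E.
Proof.
move=> d0; have [ab|] := pselect (forall i, a 0 i <= b 0 i); last first.
  move=> /existsNP[i /negP]; rewrite -ltNge => abi.
  have -> : hits_few r d M (box a b) = set0.
    apply/seteqP; split => // x [[v [_ [_ _ /(_ i)H]]] _].
    have /andP[h1 h2] := H; by have := le_lt_trans (le_trans h1 h2) abi; rewrite ltxx.
  rewrite measure0 lee_fin !mulr_ge0 ?exprn_ge0 ?invr_ge0 ?(ltW d0)//.
  exact: box_vol_ge0.
have mB : measurable (hits_few r d M (box a b)).
  by apply: X_sets_measurable; exact: X_sets_hits_few.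
pose q : {poly R} := r%:R *: \prod_i (((b 0 i - a 0 i) / d)%:P + 'X).
have qE e : q.[e] = r%:R * \prod_i ((b 0 i - a 0 i) / d + e).
  by rewrite hornerZ horner_prod; congr (_ * _); apply: eq_bigr => i _; rewrite !hornerE.
have -> : r%:R * d^-1 ^+ p * box_vol a b = q.[0].
  rewrite qE -mulrA; congr (_ * _); rewrite -[p in _ ^+ p]card_ord -prodr_const.
  rewrite -big_split/=; apply: eq_bigr => i _.
  by rewrite addr0 mulrC max_l// subr_ge0.
have muq e : 0 < e -> (mu (hits_few r d M (box a b)) <= q.[e]%:E)%E.
  move=> e0; rewrite qE; apply: hits_few_grid => // i.
    by rewrite ltr_wpDl// divr_ge0 ?subr_ge0// ltW.
  rewrite ger0_norm ?subr_ge0// mulrDr mulrCA divff ?gt_eqF// mulr1.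
  by rewrite ltrDl mulr_gt0.
rewrite -(fineK (fin_num_measure mu _ mB)) lee_fin leNgt; apply/negP => qlt.
have /cvgr_lt/(_ _ qlt) := @continuous_horner R q 0.
move=> /nbhs_ballP[e /= e0 He].
have := He (e / 2); rewrite /ball/= sub0r normrN gtr0_norm ?divr_gt0//.
have e2 : e / 2 < e by lra.
move=> /(_ e2); rewrite ltNge => /negP; apply.
by rewrite -lee_fin fineK ?fin_num_measure// muq// divr_gt0.
Qed.

(** The constant in the box bound does not depend on the box, so countable covers of [B] of small
    total volume give measurable covers of the event of small measure; their intersection is a
    measurable null set. *)
Lemma hits_few_negligible (r : nat) (d M : R) (B : set 'rV[R]_p) : 0 < d ->
  leb_null B -> mu.-negligible (hits_few r d M B).
Proof.
move=> d0 B0; pose C := r%:R * d^-1 ^+ p.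
have C0 : 0 <= C by rewrite mulr_ge0// exprn_ge0// invr_ge0 ltW.
have cover (q : nat) : exists E : set (Xsp R n), [/\ measurable E,
    hits_few r d M B `<=` E & (mu E <= (q.+1%:R^-1)%:E)%E].
  (* Total volume [q.+1^-1 / (C + 1)] is requested from the cover; the 1 allows for [C = 0], which
     happens when [r = 0]. *)
  have C1 : 0 < C + 1 by rewrite ltr_wpDl.
  have q0 : (0 : R) < q.+1%:R^-1 by rewrite invr_gt0 ltr0n.
  have [a [b [Bab abq]]] := B0 _ (divr_gt0 q0 C1).
  have mU i : measurable (hits_few r d M (box (a i) (b i))).
    by apply: X_sets_measurable; exact: X_sets_hits_few.
  exists (\bigcup_i hits_few r d M (box (a i) (b i))); split.
  - exact: bigcup_measurable.
  - move=> x [[v [pv [vd vM vB]]] fx]; have [i _ vi] := Bab _ vB.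
    by exists i => //; split => //; exists v.
  apply: le_trans (measure_sigma_subadditive mu mU _ _) _ => //.
    exact: bigcup_measurable.
  apply: lime_le; first exact: is_cvg_nneseries.
  apply: nearW => N.
  apply: (@le_trans _ _ (\sum_(0 <= i < N) (C * box_vol (a i) (b i))%:E)%E).
    by apply: lee_sum => i _; exact: hits_few_box.
  rewrite sumEFin lee_fin big_mkord -mulr_sumr.
  apply: le_trans (ler_wpM2l C0 (abq N)) _.
  rewrite mulrCA -[leRHS]mulr1 ler_wpM2l ?(ltW q0)//.
  by rewrite ler_pdivrMr// mul1r lerDl.
have [E HE] := choice cover; exists (\bigcap_q E q); split.
- by apply: bigcapT_measurable => q; case: (HE q).
- apply/eqP; rewrite eq_le measure_ge0 andbT; apply/lee_addgt0Pr => e e0.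
  have [q _ /(_ _ (leqnn q)) qe] := near_infty_natSinv_lt (PosNum e0).
  rewrite add0e (@le_trans _ _ (mu (E q)))//.
    apply: le_measure; rewrite ?inE//; last by move=> x; apply.
      by apply: bigcapT_measurable => q'; case: (HE q').
    by case: (HE q).
  by case: (HE q) => _ _ /le_trans; apply; rewrite lee_fin ltW.
- by move=> x Bx q _; case: (HE q) => _ + _; exact.
Qed.

End null_sets.

Lemma finite_int_ball {n : nat} (k : nat) :
  finite_set [set a : 'rV[int]_n | forall i, (`|a ord0 i| <= k)%N].
Proof.
apply: (@sub_finite_set _ _ (range (fun f : {ffun 'I_n -> 'I_(k + k).+1} =>
    (\row_i ((f i : nat)%:Z - k%:Z))))).
  move=> a ak; exists [ffun i => inord `|a 0 i + k%:Z|] => //.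
  apply/rowP => i; rewrite mxE ffunE; have : (`|a 0%R i| <= k)%N := ak i.
  move: (a 0 i) => z zk; rewrite inordK; last by lia.
  by rewrite gez0_abs; lia.
exact/finite_image/finite_finset.
Qed.

(** A single finite list serves all [y] near [x]; this uniformity is what makes point counts locally
    constant. *)
Lemma bounded_points_near {R : realType} {n : nat} (x : SL R n) (M : R) :
  exists d (s : seq 'rV[int]_n.+1), 0 < d /\
    forall y : SL R n, mxdist (val x) (val y) d ->
    forall a : 'rV[int]_n.+1, sup_ball M (map_mx intr a *m val y) -> a \in s.
Proof.
pose S := \sum_i \sum_c `|\adj (val x) c i|.
have S0 : 0 <= S by apply: sumr_ge0 => i _; exact: sumr_ge0.
(* With [T] the sum of the [|a_i|], the identity [a = (a x) \adj x] gives [T <= (M + T d) S]. This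
   choice of [d] makes [T d S <= T / 2], whence [T <= 2 M S]. *)
have d0 : 0 < (2 * (S + 1))^-1 by rewrite invr_gt0 mulr_gt0// ltr_wpDl.
have /finite_seqP[s sE] := @finite_int_ball n.+1 (Num.truncn (2 * M * S)).
exists (2 * (S + 1))^-1, s; split => // y xy a ay.
suff : [set` s] a by [].
rewrite -sE /= => i; pose T := \sum_i `|(a 0 i)%:~R : R|.
have T0 : 0 <= T by exact: sumr_ge0.
have ax c : `|(map_mx intr a *m val x) 0 c| <= M + T * (2 * (S + 1))^-1.
  rewrite -[val x](subrK (val y)) mulmxDr mxE addrC (le_trans (ler_normD _ _))//.
  rewrite lerD ?ay// mxE (le_trans (ler_norm_sum _ _ _))// mulr_suml.
  apply: ler_sum => l _; rewrite !mxE normrM ler_wpM2l//.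
  exact/ltW/xy.
have aT : T <= (M + T * (2 * (S + 1))^-1) * S.
  rewrite mulr_sumr; apply: ler_sum => l _.
  have -> : (a 0 l)%:~R = (map_mx intr a *m val x *m \adj (val x)) 0 l :> R.
    by rewrite -mulmxA mul_mx_adj (eqP (valP x)) mulmx1 mxE.
  rewrite mxE mulr_sumr (le_trans (ler_norm_sum _ _ _))//.
  by apply: ler_sum => c _; rewrite normrM ler_wpM2r.
have ST : T * (2 * (S + 1))^-1 * S <= T / 2.
  rewrite -mulrA ler_wpM2l// invfM -mulrA ger_pMr ?invr_gt0//.
  by rewrite mulrC ler_pdivrMr ?mul1r ?lerDl// ltr_wpDl.
have TM : T <= 2 * M * S by lra.
have aiT : `|(a 0 i)%:~R : R| <= T.
  by rewrite /T (bigD1 i)//= lerDl sumr_ge0.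
rewrite truncn_ge_nat; last by rewrite (le_trans T0).
apply: le_trans TM; apply: le_trans aiT.
by rewrite -intr_norm -natr_absz.
Qed.

Lemma finite_bounded_points {R : realType} {n : nat} (x : SL R n) (M : R) :
  finite_set (prim_points (sup_ball M) x).
Proof.
have [d [s [d0 H]]] := bounded_points_near x M.
apply: (@sub_finite_set _ _ [set` s]); last exact: finite_seq.
by move=> a [_ /H]; apply => i j; rewrite subrr normr0.
Qed.

Lemma negligible_bigcup_countable {d} {T : measurableType d} {R : realType}
    (mu : {measure set T -> \bar R}) (I : countType) (F : I -> set T) :
  (forall i, mu.-negligible (F i)) -> mu.-negligible (\bigcup_i F i).
Proof.
move=> F0; pose G k := if unpickle k is Some i then F i else set0.
apply: (@negligibleS _ _ _ _ (\bigcup_k G k)).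
  by move=> x [i _ Fix]; exists (pickle i) => //; rewrite /G pickleK.
apply: negligible_bigcup => k; rewrite /G; case: unpickle => //.
exact: negligible_set0.
Qed.

(** Each lattice in this event lies in some [hits_few] with [d = 1 / (q + 1)] and [M = q], where [r]
    is its finite number of points in the ball of radius [2 q]; there are countably many pairs
    [(q, r)]. *)
Lemma chart_negligible {R : realType} {n p : nat} (mu : probability (Xsp R n) R)
    (sigma : 'I_p -> 'I_n.+1) (j : 'I_n.+1) (g : R -> R) (B : set 'rV[R]_p) :
  right_G_invariant mu -> injective sigma -> (forall i, sigma i != j) ->
  measurable_fun [set: R] g -> leb_null B ->
  mu.-negligible [set x : Xsp R n | prim_points
    [set y : 'rV[R]_n.+1 | y 0 j * g (y 0 j) != 0 /\ B (chart sigma j g y)] x !=set0].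
Proof.
move=> mu_inv sinj sNj mg B0.
apply: (@negligibleS _ _ _ _ (\bigcup_(q : nat) \bigcup_(r : nat)
    hits_few sigma j g r q.+1%:R^-1 q%:R B)).
  move=> x [a [pa [aj aB]]]; set y := _ *m val x in aj aB.
  have aj0 : 0 < `|y 0 j * g (y 0 j)| by rewrite normr_gt0.
  have [q1 _ Hq1] := near_infty_natSinv_lt (PosNum aj0).
  pose q2 := (Num.truncn (\sum_i `|y 0 i|)).+1.
  exists (maxn q1 q2) => //; set M : R := (maxn q1 q2)%:R.
  have /finite_setP[r xr] := finite_bounded_points x (M + M).
  exists r => //; split; last by exists r.
  exists a; split => //; split => //.
    by apply/ltW/Hq1; rewrite /= leq_maxl.
  move=> i; apply: (@le_trans _ _ (\sum_i `|y 0 i|)).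
    by rewrite (bigD1 i)//= lerDl sumr_ge0.
  apply: (@le_trans _ _ q2%:R); last by rewrite ler_nat leq_maxr.
  exact/ltW/truncnS_gt.
apply: negligible_bigcup => q; apply: negligible_bigcup => r.
by apply: hits_few_negligible => //; rewrite invr_gt0 ltr0n.
Qed.

(** * Topological boundaries *)

Lemma mxdistW {R : realType} {p q : nat} (A B : 'M[R]_(p, q)) (d e : R) :
  d <= e -> mxdist A B d -> mxdist A B e.
Proof. by move=> de AB i j; exact: lt_le_trans (AB i j) de. Qed.

Lemma mxdist_near_seq {R : realType} {p q : nat} {I : eqType}
    (A : 'M[R]_(p, q)) (s : seq I) (Q : I -> 'M[R]_(p, q) -> Prop) :
  (forall i, i \in s -> exists2 e : R, 0 < e & forall B, mxdist A B e -> Q i B) ->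
  exists2 e : R, 0 < e & forall B, mxdist A B e -> forall i, i \in s -> Q i B.
Proof.
elim: s => [_|i s IH H]; first by exists 1.
have [e1 e10 H1] := H i (mem_head _ _).
have [e2 e20 H2] : exists2 e : R, 0 < e &
    forall B, mxdist A B e -> forall i, i \in s -> Q i B.
  by apply: IH => k ks; apply: H; rewrite inE ks orbT.
exists (Num.min e1 e2); first by rewrite lt_min e10.
move=> B AB k; rewrite inE => /predU1P[->|].
  by apply: H1; apply: mxdistW AB; rewrite ge_min lexx.
by apply: H2; apply: mxdistW AB; rewrite ge_min lexx orbT.
Qed.

Lemma rv_boundaryPn {R : realType} {p : nat} (A : set 'rV[R]_p) (y : 'rV[R]_p) :
  ~ rv_boundary A y ->
  exists2 e : R, 0 < e & forall z, mxdist y z e -> (A z <-> A y).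
Proof.
move=> /existsNP[e /not_implyP[e0 /not_andP[]]] /forallNP H; exists e => // z yz.
  have NA w : mxdist y w e -> ~ A w by move=> yw Aw; exact: (H w).
  by split => [/(NA _ yz)//|/NA[]] i l; rewrite subrr normr0.
have AA w : mxdist y w e -> A w by move=> yw; apply: contrapT => Aw; exact: (H w).
by split => _; apply: AA => // i l; rewrite subrr normr0.
Qed.

(** Near [x] only finitely many [a] can be points of [C], and for each of them [a x] is off the
    boundary, so membership in [C] is stable under small perturbations. *)
Lemma prim_points_locally_constant {R : realType} {n : nat} (C : set 'rV[R]_n.+1)
    (M : R) (x : SL R n) : C `<=` sup_ball M ->
  prim_points (rv_boundary C) x = set0 ->
  exists2 e : R, 0 < e & forall y : SL R n, mxdist (val x) (val y) e ->
    prim_points C y = prim_points C x.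
Proof.
move=> CM Cx; have [d [s [d0 H]]] := bounded_points_near x M.
have [e e0 He] : exists2 e : R, 0 < e & forall B, mxdist (val x) B e ->
    forall a, a \in [seq a <- s | `[< primitive a >]] ->
      (C (map_mx intr a *m B) <-> C (map_mx intr a *m val x)).
  apply: mxdist_near_seq => a; rewrite mem_filter => /andP[/asboolP pa _].
  have /rv_boundaryPn[e e0 He] : ~ rv_boundary C (map_mx intr a *m val x).
    by move=> aC; have : prim_points (rv_boundary C) x a by []; rewrite Cx.
  have [c c0 Hc] := @mxdist_mulmx R 1 n.+1 n.+1 (map_mx intr a) e e0.
  by exists c => // B xB; apply: He; exact: Hc.
exists (Num.min d e); first by rewrite lt_min d0.
move=> y xy; have xyd : mxdist (val x) (val y) d.
  by apply: mxdistW xy; rewrite ge_min lexx.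
have xye : mxdist (val x) (val y) e.
  by apply: mxdistW xy; rewrite ge_min lexx orbT.
have xx : mxdist (val x) (val x) d by move=> i j; rewrite subrr normr0.
have mem a : primitive a -> a \in s -> a \in [seq a <- s | `[< primitive a >]].
  by move=> pa as_; rewrite mem_filter as_ andbT; exact/asboolP.
apply/seteqP; split => a [pa aC]; split => //; have /CM := aC.
  by move=> /(H _ xyd) as_; apply: (He _ xye a (mem _ pa as_)).1.
by move=> /(H _ xx) as_; apply: (He _ xye a (mem _ pa as_)).2.
Qed.

Lemma SL_boundary_card_subset {R : realType} {n r : nat}
    (C : 'I_r -> set 'rV[R]_n.+1) (N : 'I_r -> nat) :
  (forall i, exists M, C i `<=` sup_ball M) ->
  SL_boundary [set x : SL R n | forall i, prim_points (C i) x #= `I_(N i)] `<=`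
  \bigcup_i [set x | prim_points (rv_boundary (C i)) x !=set0].
Proof.
move=> CM x bx; apply: contrapT => nx.
have [e e0 He] : exists2 e : R, 0 < e & forall B, mxdist (val x) B e ->
    forall i, i \in enum 'I_r -> forall y : SL R n, val y = B ->
      prim_points (C i) y = prim_points (C i) x.
  apply: mxdist_near_seq => i _; have [M CiM] := CM i.
  have [|e e0 He] := prim_points_locally_constant (C i) M x CiM.
    apply: contrapT => /eqP/set0P Cx; apply: nx; by exists i.
  by exists e => // B xB y yB; apply: He; rewrite yB.
have [[y [yE xy]] [z [zE xz]]] := bx _ e0.
apply: zE => i; rewrite (He _ xz i _ z erefl) ?mem_enum//.
by rewrite -(He _ xy i _ y erefl) ?mem_enum//; exact: yE.
Qed.

Lemma Gamma_boundary {R : realType} {n : nat} (E : set (SL R n)) gam (x y : SL R n) :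
  Gamma_inv E -> Gamma gam -> val y = gam *m val x ->
  SL_boundary E x -> SL_boundary E y.
Proof.
move=> iE Gg yE bx e e0.
have [d d0 Hd] := @mxdist_mulmx R n.+1 n.+1 n.+1 gam _ e0.
have g1 : \det gam == 1.
  by move: Gg => [Z [-> Z1]]; rewrite det_map_mx Z1 rmorph1.
pose G : SL R n := exist _ gam g1.
have GE z : E (SLmul G z) <-> E z by split => /(iE gam z (SLmul G z) Gg erefl).
have [[z [Ez xz]] [w [Ew xw]]] := bx d d0; split.
  by exists (SLmul G z); split; [exact/GE|rewrite yE; exact: Hd].
by exists (SLmul G w); split; [move=> /GE|rewrite yE; exact: Hd].
Qed.

(** The boundary is closed, hence Borel. Its measurability in [Xsp] is what turns negligibility into
    measure zero, as admissibility requires. *)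
Lemma X_sets_boundary {R : realType} {n : nat} (E : set (SL R n)) :
  Gamma_inv E -> X_sets (SL_boundary E).
Proof.
move=> iE; split; last first.
  move=> gam x y Gg yE; split; first exact: Gamma_boundary Gg yE.
  move: Gg => [Z [gZ Z1]].
  have ZZ' : \adj Z *m Z = 1%:M by rewrite mul_adj_mx Z1.
  apply: (@Gamma_boundary _ _ _ (map_mx intr (\adj Z))) => //.
    exists (\adj Z); split => //.
    by have := congr1 determinant ZZ'; rewrite det_mulmx Z1 mulr1 det1.
  by rewrite yE gZ mulmxA -map_mxM ZZ' map_mx1 mul1mx.
rewrite -[X in SL_borel X]setCK; apply: (@measurableC _ (Gsp R n)).
apply: sub_sigma_algebra => x /= /existsNP[e /not_implyP[e0 H]].
exists (e / 2); first by rewrite divr_gt0.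
move=> y xy /(_ (e / 2)); rewrite divr_gt0// => /(_ isT)[[z [Ez yz]] [w [Ew yw]]].
have tri (v : SL R n) : mxdist (val y) (val v) (e / 2) -> mxdist (val x) (val v) e.
  move=> yv i j; have := xy i j; have := yv i j; rewrite !ltr_distlC; lra.
by apply: H; split; [exists z; split => //; exact: tri|exists w; split => //; exact: tri].
Qed.

(** * Cones *)

Lemma measurable_inv {R : realType} : measurable_fun [set: R] (@GRing.inv R).
Proof.
(* Inversion is discontinuous at 0; this formula is built from measurable functions and respects the
   convention that the inverse of 0 is 0. *)
have -> : @GRing.inv R = (fun t => t * (t ^+ 2) `^ (- 1)).
  apply/funext => t; have [->|t0] := eqVneq t 0; first by rewrite invr0 mul0r.
  by rewrite powR_inv1 ?sqr_ge0// expr2 invfM mulrA divff// mul1r.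
apply: measurable_funM => //.
by apply: (@measurable_comp _ _ _ _ _ _ setT (fun u : R => u `^ (- 1)) _ (fun t : R => t ^+ 2)).
Qed.

(** For a lattice vector [v] with [v_n] nonzero this is the hitting time [v'/v_n]; it is 0 by
    convention when [v_n = 0]. *)
Definition slope {R : realType} {k m : nat} (y : 'rV[R]_((k + m).+1)) : 'rV[R]_k :=
  (ylast y)^-1 *: yp y.

Lemma slope_chart {R : realType} {k m : nat} (y : 'rV[R]_((k + m).+1)) :
  slope y = chart (fun i : 'I_k => inord i) ord_max GRing.inv y.
Proof. by apply/rowP => i; rewrite chartE !mxE mulrC. Qed.

Lemma ypp_chart {R : realType} {k m : nat} (j : 'I_(k + m).+1)
    (y : 'rV[R]_((k + m).+1)) :
  ypp y = chart (fun i : 'I_m.+1 => inord (k + i)) j (cst 1) y.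
Proof. by apply/rowP => i; rewrite chartE !mxE mulr1. Qed.

Lemma ypp_last {R : realType} {k m : nat} (y : 'rV[R]_((k + m).+1)) :
  ypp y 0 ord_max = ylast y.
Proof. by rewrite mxE /ylast; congr (y 0 _); apply: val_inj; rewrite /= inordK. Qed.

Lemma coneE {R : realType} {k m : nat} (A : set 'rV[R]_k) (W : set 'rV[R]_m.+1)
    (y : 'rV[R]_((k + m).+1)) : (forall w, W w -> 0 < w 0 ord_max) ->
  cone A W y <-> A (slope y) /\ W (ypp y).
Proof.
move=> W_pos; split=> [[[a Aa yE] Wy]|[Ay Wy]]; have := W_pos _ Wy;
  rewrite ypp_last => y0; split => //.
  by rewrite /slope yE scalerA mulVf ?gt_eqF// scale1r.
by exists (slope y) => //; rewrite scalerA divff ?gt_eqF// scale1r.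
Qed.

Lemma cone_bounded {R : realType} {k m : nat} (A : set 'rV[R]_k)
    (W : set 'rV[R]_m.+1) : rv_bounded A -> rv_bounded W ->
  exists M, @cone R k m A W `<=` sup_ball M.
Proof.
move=> [MA AM] [MW WM]; exists (`|MW| * `|MA| + `|MW|) => y [[a Aa yE] Wy] i.
have yM (c : 'I_m.+1) : `|ypp y 0 c| <= `|MW|.
  exact: le_trans (WM _ Wy c) (ler_norm _).
have [ik|ki] := ltnP i k.
  have -> : y 0 i = ylast y * a 0 (Ordinal ik).
    have /rowP/(_ (Ordinal ik)) := yE; rewrite !mxE => <-.
    by congr (y 0 _); apply: val_inj; rewrite /= inordK.
  rewrite normrM -[leLHS]addr0 lerD// ler_pM//.
    by rewrite -ypp_last.
  exact: le_trans (AM _ Aa _) (ler_norm _).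
have im : (i - k < m.+1)%N by have := ltn_ord i; lia.
have -> : y 0 i = ypp y 0 (Ordinal im).
  rewrite mxE; congr (y 0 _); apply: val_inj; rewrite /= subnKC//.
  by rewrite /= inordK.
by rewrite -[leLHS]add0r lerD// mulr_ge0.
Qed.

Lemma SL_borel_cone {R : realType} {k m : nat} (A : set 'rV[R]_k)
    (W : set 'rV[R]_m.+1) (v : 'rV[R]_((k + m).+1)) :
  (forall w, W w -> 0 < w 0 ord_max) -> rv_borel A -> rv_borel W ->
  SL_borel [set x : SL R (k + m) | cone A W (v *m val x)].
Proof.
move=> W_pos bA bW.
have -> : [set x : SL R (k + m) | cone A W (v *m val x)] =
    [set x | A (slope (v *m val x))] `&` [set x | W (ypp (v *m val x))].
  by apply/seteqP; split => x /=; rewrite coneE.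
apply: (@measurableI _ (Gsp R (k + m))).
- have -> : [set x : Gsp R (k + m) | A (slope (v *m val x))] =
      [set x : Gsp R (k + m) | A (\row_i
       ((ylast (v *m val x))^-1 * (v *m val x) 0 (inord i)))].
    apply/funext => x /=; congr (A _); apply/rowP => i.
    by rewrite [LHS]mxE [RHS]mxE; congr (_ * _); rewrite [LHS]mxE.
  apply: rv_borel_preimage => // i; apply: measurable_funM.
    by apply: (measurableT_comp measurable_inv); exact: measurable_act.
  exact: measurable_act.
apply: (@rv_borel_preimage _ _ (Gsp R (k + m)) _
  (fun (i : 'I_m.+1) (x : Gsp R (k + m)) => (v *m val x) 0 (inord (k + i)))) => // i.
exact: measurable_act.
Qed.

Lemma chart_near {R : realType} {n p : nat} (sigma : 'I_p -> 'I_n.+1)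
    (j : 'I_n.+1) (g : R -> R) (y : 'rV[R]_n.+1) (e : R) :
  {for y 0 j, continuous g} -> 0 < e ->
  exists2 d : R, 0 < d & forall z, mxdist y z d ->
    mxdist (chart sigma j g y) (chart sigma j g z) e.
Proof.
move=> cg e0.
have ci i : (fun z : 'rV[R]_n.+1 => z 0 (sigma i) * g (z 0 j)) @ y -->
    (y 0 (sigma i) * g (y 0 j)).
  apply: (@cvgM _ _ (nbhs y) (nbhs_filter y) (fun z : 'rV[R]_n.+1 => z 0 (sigma i))
    (fun z => g (z 0 j))).
    exact: coord_continuous.
  apply: (@continuous_comp _ _ _ (fun z : 'rV[R]_n.+1 => z 0 j)) => //.
  exact: coord_continuous.
have : nbhs y (fun z : 'rV[R]_n.+1 => forall i,
    ball (y 0 (sigma i) * g (y 0 j)) e (z 0 (sigma i) * g (z 0 j))).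
  apply: (@filter_forall _ _ (fun i (z : 'rV[R]_n.+1) =>
    ball (y 0 (sigma i) * g (y 0 j)) e (z 0 (sigma i) * g (z 0 j)))
    (nbhs y) (nbhs_filter y)) => i.
  have /cvgrPdist_lt/(_ e e0) := ci i.
  by apply.
move=> /nbhs_ballP[d /= d0 Hd]; exists d => // z yz l i.
by rewrite (ord1 l) !chartE; apply: Hd.
Qed.

(** Where [y_n] is nonzero, [slope] and [ypp] are continuous, so off both boundaries the two
    membership conditions are locally constant. *)
Lemma rv_boundary_cone {R : realType} {k m : nat} (A : set 'rV[R]_k)
    (W : set 'rV[R]_m.+1) (y : 'rV[R]_((k + m).+1)) :
  (forall w, W w -> 0 < w 0 ord_max) -> rv_boundary (cone A W) y ->
  ylast y != 0 -> rv_boundary A (slope y) \/ rv_boundary W (ypp y).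
Proof.
move=> W_pos yb y0; apply: contrapT => /not_orP[].
move=> /rv_boundaryPn[e1 e10 H1] /rv_boundaryPn[e2 e20 H2].
have [|d1 d10 D1] := chart_near (fun i : 'I_k => inord i) ord_max GRing.inv y e1 _ e10.
  exact: inv_continuous.
have [|d2 d20 D2] := chart_near (fun i : 'I_m.+1 => inord (k + i)) ord_max (cst 1) y e2 _ e20.
  exact: cvg_cst.
have d0 : 0 < Num.min d1 d2 by rewrite lt_min d10.
have const z : mxdist y z (Num.min d1 d2) -> cone A W z <-> cone A W y.
  move=> yz; rewrite !coneE// !slope_chart !(ypp_chart ord_max).
  rewrite H1 ?slope_chart.
    rewrite H2 ?(ypp_chart ord_max)//; apply: D2; apply: mxdistW yz.
    by rewrite ge_min lexx orbT.
  by apply: D1; apply: mxdistW yz; rewrite ge_min lexx.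
have [[z [Cz yz]] [w [nCw yw]]] := yb _ d0.
by apply: nCw; apply/(const _ yw)/(const _ yz).
Qed.

(** The dimension is positive: in dimension 0 a point has volume 1, the empty product. *)
Lemma leb_null_singleton {R : realType} {p : nat} (y : 'rV[R]_p.+1) :
  leb_null [set y].
Proof.
move=> e e0; exists (fun=> y), (fun=> y); split.
  by move=> _ ->; exists 0 => // i; rewrite lexx.
move=> N; rewrite big1 ?(ltW e0)// => i _.
by rewrite /box_vol big_ord_recl subrr maxxx mul0r.
Qed.

(** A one-dimensional chart with null set [{0}]. These events absorb the vectors with a vanishing
    coordinate, on which the charts used for cones degenerate. *)
Lemma coordinate_hyperplane_negligible {R : realType} {n : nat}
    (mu : probability (Xsp R n) R) (l c : 'I_n.+1) :
  right_G_invariant mu -> l != c ->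
  mu.-negligible [set x : Xsp R n | prim_points
    [set y : 'rV[R]_n.+1 | y 0 c != 0 /\ y 0 l = 0] x !=set0].
Proof.
move=> mu_inv lc.
apply: negligibleS (chart_negligible mu (fun _ : 'I_1 => l) c (cst 1) _ mu_inv
  _ _ _ (leb_null_singleton 0)) => //.
- move=> x [a [pa [ac al]]]; exists a; split => //; split; first by rewrite mulr1.
  by apply/rowP => i; rewrite chartE al mul0r mxE.
- by move=> i i' _; rewrite (ord1 i) (ord1 i').
Qed.

Lemma prim_vector_neq0 {R : realType} {n : nat} (x : SL R n) (a : 'rV[int]_n.+1) :
  primitive a -> exists c, (map_mx intr a *m val x) 0 c != 0.
Proof.
move=> pa; apply: contrapT => /forallNP H.
have ax0 : map_mx intr a *m val x = 0.
  by apply/rowP => c; rewrite [RHS]mxE; apply/eqP/negPn/negP.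
(* If [a x = 0] then [a = 0], and 2 divides every entry of [a]. *)
suff : (`|2| : int) = 1 by [].
apply: pa => i; have : (map_mx intr a *m val x *m \adj (val x)) 0 i = 0 :> R.
  by rewrite ax0 mul0mx mxE.
rewrite -mulmxA mul_mx_adj (eqP (valP x)) mulmx1 mxE => /eqP.
by rewrite intr_eq0 => /eqP ->; rewrite dvdz0.
Qed.

(** A boundary vector has [y_n = 0] and another coordinate nonzero, or its slope lies on the
    boundary of [A], or [(y'', y_n)] lies on that of [W]. The last two cases use charts with [g] the
    inverse and [g = 1]. *)
Lemma boundary_cone_negligible {R : realType} {k m : nat} (k_ge1 : (1 <= k)%N)
    (mu : probability (Xsp R (k + m)) R) (A : set 'rV[R]_k) (W : set 'rV[R]_m.+1) :
  right_G_invariant mu -> (forall w, W w -> 0 < w 0 ord_max) ->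
  leb_null (rv_boundary A) -> leb_null (rv_boundary W) ->
  mu.-negligible [set x : Xsp R (k + m) |
    prim_points (rv_boundary (cone A W)) x !=set0].
Proof.
move=> mu_inv W_pos A0 W0.
pose H (lc : 'I_(k + m).+1 * 'I_(k + m).+1) : set (Xsp R (k + m)) :=
  if lc.1 != lc.2 then [set x | prim_points
    [set y : 'rV[R]_(k + m).+1 | y 0 lc.2 != 0 /\ y 0 lc.1 = 0] x !=set0] else set0.
have H0 lc : mu.-negligible (H lc).
  rewrite /H; case: ifP => [lc12|_]; last exact: negligible_set0.
  exact: coordinate_hyperplane_negligible.
have kn i : (i < k -> i < (k + m).+1)%N by lia.
have kmn i : (i < m.+1 -> k + i < (k + m).+1)%N by lia.
have n0 (i : 'I_m.+1) : inord (k + i) != inord 0 :> 'I_(k + m).+1.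
  by rewrite -val_eqE /= !inordK ?kmn//; lia.
have nA := chart_negligible mu (fun i : 'I_k => inord i) ord_max GRing.inv
  (rv_boundary A) mu_inv.
(* The coordinate driving the shear must lie outside [(y'', y_n)]; [k >= 1] provides the first
   coordinate of [y']. The case where it vanishes is left to the hyperplane events. *)
have nW := chart_negligible mu (fun i : 'I_m.+1 => inord (k + i)) (inord 0) (cst 1)
  (rv_boundary W) mu_inv.
have {}nA := nA _ _ measurable_inv A0.
have {}nW := nW _ n0 (measurable_cst _) W0.
apply: negligibleS (negligibleU (negligible_bigcup_countable mu _ H H0)
  (negligibleU (nA _ _) (nW _))).
- move=> x [a [pa ab]]; set y := map_mx intr a *m val x in ab.
  have [yn0|yn0] := eqVneq (ylast y) 0.
    have [c yc] := prim_vector_neq0 x a pa; left; exists (ord_max, c) => //.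
    rewrite /H/= ifT; first by exists a.
    by apply: contraNneq yc => <-; exact/eqP.
  have [bA|bW] := rv_boundary_cone A W y W_pos ab yn0.
    right; left; exists a; split => //; split; first by rewrite divff// oner_neq0.
    by rewrite -slope_chart.
  have [y00|y00] := eqVneq (y 0 (inord 0)) 0.
    left; exists (inord 0, ord_max) => //; rewrite /H/= ifT; first by exists a.
    by rewrite -val_eqE /= inordK//; lia.
  right; right; exists a; split => //; split; first by rewrite mulr1.
  by rewrite -ypp_chart.
- by move=> i i' /(congr1 val)/=; rewrite !inordK ?kn// => /val_inj.
- by move=> i; rewrite -val_eqE /= inordK ?kn//; have := ltn_ord i; lia.
- move=> i i' /(congr1 val)/=; rewrite !inordK ?kmn// => /eqP.
  by rewrite eqn_add2l => /eqP/val_inj.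
Qed.

(** * Renormalization by the diagonal flow *)

Lemma det_Phi {R : realType} (k m : nat) (t : R) : \det (Phi k m t) == 1.
Proof.
rewrite det_diag (eq_bigr (fun i : 'I_(k + m).+1 => if (i < k)%N
  then expR (m.+1%:R * t) else expR (- (k%:R * t)))); last by move=> i _; rewrite mxE.
rewrite -(big_mkord xpredT (fun i => if (i < k)%N
  then expR (m.+1%:R * t) else expR (- (k%:R * t)))).
rewrite (@big_cat_nat _ _ _ k)//=; last by lia.
rewrite (@eq_big_nat _ _ _ 0 k _ (fun=> expR (m.+1%:R * t))); last first.
  by move=> i /andP[_ ->].
rewrite (@eq_big_nat _ _ _ k _ _ (fun=> expR (- (k%:R * t)))); last first.
  by move=> i /andP[ki _]; rewrite ltnNge ki.
rewrite !prodr_const_nat subn0 -!expRM_natl -expRD; apply/eqP.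
rewrite -[RHS]expR0; congr expR; rewrite -addnS addKn.
by ring.
Qed.

Lemma mul_Phi {R : realType} (k m : nat) (t : R) (y : 'rV[R]_(k + m).+1) i :
  (y *m Phi k m t) 0 i =
  y 0 i * (if (i < k)%N then expR (m.+1%:R * t) else expR (- (k%:R * t))).
Proof. by rewrite mul_mx_diag !mxE. Qed.

Lemma PhiN {R : realType} (k m : nat) (t : R) : Phi k m t *m Phi k m (- t) = 1%:M.
Proof.
apply/row_matrixP => i; rewrite row_mul row1 rowE; apply/rowP => c.
rewrite !mul_Phi -mulrA; case: ifP => _; rewrite -expRD.
  by rewrite mulrN subrr expR0 mulr1.
by rewrite mulrN subrr expR0 mulr1.
Qed.

(** With [t = ln L / k], [Phi (- t)] multiplies [(y'', y_n)] by [e^(kt) = L] and [y'] by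
    [e^(-(m+1)t)], hence the slope by [e^(-(k+m+1)t) = L^(-n/k)]. *)
Lemma hit_points_Phi {R : realType} {k m : nat} (k_ge1 : (1 <= k)%N)
    (A : set 'rV[R]_k) (W : set 'rV[R]_m.+1) (L : R) (x y : SL R (k + m)) :
  (forall w, W w -> 0 < w 0 ord_max) -> 0 < L ->
  val y = val x *m Phi k m (- (ln L / k%:R)) ->
  hit_points W L A x = cone_points A W y.
Proof.
move=> W_pos L0 yE; set t := ln L / k%:R in yE.
have k0 : k%:R != 0 :> R by rewrite pnatr_eq0; lia.
have LE : expR (k%:R * t) = L by rewrite mulrC divfK// lnK.
have kn (i : 'I_k) : (i < (k + m).+1)%N by have := ltn_ord i; lia.
suff E (a : 'rV[int]_(k + m).+1) : primitive a ->
    (hit_points W L A x a <-> cone_points A W y a).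
  by apply/seteqP; split => a aE; have [pa _] := aE; apply/(E a pa).
move=> pa; rewrite /hit_points /cone_points /= yE mulmxA.
set v := map_mx intr a *m val x; rewrite coneE//.
have -> : ypp (v *m Phi k m (- t)) = L *: ypp v.
  apply/rowP => i; rewrite mxE mul_Phi inordK; last by have := ltn_ord i; lia.
  by rewrite ltnNge leq_addr/= mulrN opprK LE !mxE mulrC.
have -> : slope (v *m Phi k m (- t)) =
    L `^ (- ((k + m).+1%:R / k%:R)) *: ((ylast v)^-1 *: yp v).
  apply/rowP => i; rewrite [LHS]mxE [X in _ * X]mxE /ylast !mul_Phi inordK ?kn//.
  rewrite ltn_ord ltnNge leq_addr/= mulrN opprK.
  rewrite [RHS]mxE [X in _ = _ * X]mxE [X in _ = _ * (_ * X)]mxE.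
  have -> : L `^ (- ((k + m).+1%:R / k%:R)) =
      (expR (k%:R * t))^-1 * expR (m.+1%:R * - t).
    rewrite /powR gt_eqF// -expRN -expRD; congr expR; rewrite /t.
    by field.
  by rewrite invfM; ring.
split=> [[_ [[w Ww <-] Av]]|[_ [Av Wv]]]; split => //; split => //.
  by rewrite scalerA divff ?gt_eqF// scale1r.
by exists (L *: ypp v) => //; rewrite scalerA mulVf ?gt_eqF// scale1r.
Qed.

Lemma hit_set_phiset {R : realType} {k m r : nat} (k_ge1 : (1 <= k)%N)
    (W : set 'rV[R]_m.+1) (A : 'I_r -> set 'rV[R]_k) (N : 'I_r -> nat) (L : R) :
  (forall w, W w -> 0 < w 0 ord_max) -> 0 < L ->
  [set x : Xsp R (k + m) | forall i, hit_points W L (A i) x #= `I_(N i)] =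
  phiset (ln L / k%:R) [set x | forall i, cone_points (A i) W x #= `I_(N i)].
Proof.
move=> W_pos L0; set t := ln L / k%:R.
apply/seteqP; split => x /=.
  move=> H; pose P : SL R (k + m) := exist _ (Phi k m (- t)) (det_Phi k m (- t)).
  exists (SLmul x P) => [i|/=].
    by rewrite -(hit_points_Phi k_ge1 (A i) W L x) //=.
  by rewrite -mulmxA (mulmx1C (PhiN k m t)) mulmx1.
move=> [y yE xy] i; rewrite (hit_points_Phi k_ge1 _ _ _ x y) //.
by rewrite xy -mulmxA PhiN mulmx1.
Qed.

Theorem theorem2 (R : realType) (k m : nat) (k_ge1 : (1 <= k)%N)
  (mu : probability (Xsp R (k + m)) R)
  (mu_inv : right_G_invariant mu)
  (lam : probability (Xsp R (k + m)) R)
  (lam_adm : @admissible R k m mu lam)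
  (W : set 'rV[R]_m.+1)
  (W_pos : forall w, W w -> 0 < w 0 ord_max)
  (W_bd : rv_bounded W) (W_borel : rv_borel W)
  (W_int : rv_nonempty_interior W) (W_null : leb_null (rv_boundary W))
  (r : nat) (A : 'I_r -> set 'rV[R]_k)
  (A_bd : forall i, rv_bounded (A i)) (A_borel : forall i, rv_borel (A i))
  (A_null : forall i, leb_null (rv_boundary (A i)))
  (N : 'I_r -> nat) :
  lam [set x | forall i, hit_points W L (A i) x #= `I_(N i)]
    @[L --> +oo]
  --> mu [set x | forall i, cone_points (A i) W x #= `I_(N i)].
Proof.
set E := [set x : Xsp R (k + m) | forall i, cone_points (A i) W x #= `I_(N i)].
have XEi i := X_sets_card (cone (A i) W) (N i)
  (fun v => SL_borel_cone (A i) W v W_pos (A_borel i) W_borel).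
have XE : X_sets E.
  split.
    have -> : E = \bigcap_i [set x | cone_points (A i) W x #= `I_(N i)].
      by apply/seteqP; split => [x H i _|x H i]; [exact: (H i)|exact: (H i I)].
    apply: (@fin_bigcap_measurable _ (Gsp R (k + m))) => // i _.
    by case: (XEi i).
  move=> gam x y Gg yE; split => Ex i; first exact: ((XEi i).2 gam x y Gg yE).1 (Ex i).
  exact: ((XEi i).2 gam x y Gg yE).2 (Ex i).
have bE0 : mu (SL_boundary E) = 0%E.
  apply/negligibleP.
    by apply: X_sets_measurable; apply: X_sets_boundary; case: XE.
  apply: negligibleS (negligible_bigcup_countable mu _ _ (fun i =>
    boundary_cone_negligible k_ge1 mu (A i) W mu_inv W_pos (A_null i) W_null)).
  apply: SL_boundary_card_subset => i; exact: cone_bounded.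
have ln_cvg : (ln L / k%:R : R) @[L --> +oo] --> +oo.
  apply/cvgryPge => M; near=> L.
  have k0 : (0 : R) < k%:R by rewrite ltr0n.
  rewrite ler_pdivlMr//.
  have eL : expR (M * k%:R) < L by near: L; exact: nbhs_pinfty_gt.
  by rewrite -[leLHS]expRK ler_ln ?posrE ?expR_gt0 ?ltW// (lt_trans _ eL)// expR_gt0.
have := cvg_comp _ _ ln_cvg (lam_adm E (X_sets_measurable _ XE) bE0).
(* The hitting event is identified with [phiset] for [L > 0], which holds eventually. *)
apply: cvg_trans; apply: near_eq_cvg; near=> L => /=.
by rewrite hit_set_phiset//; near: L; exact: nbhs_pinfty_gt.
Unshelve. all: by end_near. Qed.
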